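(* Let $A$ be a tame commutative $\nu$-semiring and let $X=\operatorname{Spec}(A)$ be its spectrum, with structure $\nu$-sheaf $\mathscr O_X$. (i) For any $x\in X$ the $\nu$-stalk $\mathscr O_{X,x}$ of $\mathscr O_X$ is isomorphic to the local $\nu$-semiring $A_x$. (ii) For every strict $f\in\mathcal T^\circ$, the $\nu$-semiring $\mathscr O_X(\mathcal D(f))$ is isomorphic to the localized $\nu$-semiring $A_{S(f)}$. (iii) In particular, $\mathscr O_X(X)\cong A$.
   Context: An additive $\nu$-monoid is a triple $(M,\mathcal G,\nu)$, where $M$ is an additive abelian monoid with identity $0$, $\mathcal G\subseteq M$ is a distinguished partially ordered submonoid with $0<a$ for $0\neq a\in\mathcal G$, and $\nu:M\to\mathcal G$ is an idempotent monoid homomorphism (a projection onto $\mathcal G$), such that for all $a,b\in M$: (NM1) $a+b=a$ whenever $\nu(a)>\nu(b)$; (NM2) $a+b=\nu(a)$ whenever $\nu(a)=\nu(b)$; (NM3) if $a+b\notin\mathcal G$ and $a+\nu(b)\in\mathcal G$ then $a+b=\nu(a)+b$. Write $a^\nu=\nu(a)$; elements of $\mathcal G$ are called ghosts. A sum $a+b$ is redundant if $a+b=a$ or $a+b=b$. A commutative $\nu$-semiring is $A=(A,\mathcal T,\mathcal G,\nu)$, where $A$ is a commutative unital semiring with absorbing $0$, its additive monoid with $\mathcal G,\nu$ is an additive $\nu$-monoid, and $\mathcal T\subseteq A\setminus\mathcal G$ is a distinguished set (tangible elements) containing a designated subset $\mathcal T^\circ$ (persistent elements) with $A^\times\subseteq\mathcal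 T^\circ$, such that: (NS1) $a\in\mathcal T^\circ$ implies $a^n\in\mathcal T^\circ$ for all $n\in\mathbb N$; (NS2) $a+b\in\mathcal T$ implies $a+b^\nu\notin\mathcal G$, unless $a+b$ is redundant. It is tame if every $a\in A\setminus(\mathcal T\cup\mathcal G)$ can be written $a=c+d^\nu$ with $c,d\in\mathcal T$. A ghost divisor is $a\notin\mathcal G$ with $ab\in\mathcal G$ for some $b\notin\mathcal G$; $A|^*_{\rm tng}$ denotes the set of persistent elements that are not ghost divisors (a multiplicative monoid for $A$ tame). $f$ is ghostpotent if $f^k\in\mathcal G$ for some $k\in\mathbb N$. A congruence $\mathfrak A$ on $A$ is an equivalence relation $\equiv$ respecting $+$ and $\cdot$. Its ghost projection is $\mathsf G_{\rm cls}^{-1}(\mathfrak A)=\{a\mid a\equiv a^\nu\}$; its tangible projection is $\mathsf T_{\rm cls}^{-1}(\mathfrak A)=\{a\in\mathcal T\mid a\equiv t\text{ only for }t\in\mathcal T\}$. It is a $\mathfrak q$-congruence if $A^\times\subseteq\mathsf T_{\rm cls}^{-1}(\mathfrak A)$; an $\ell$-congruence if moreover $\mathsf T_{\rm cls}^{-1}(\mathfrak A)$ is a multiplicative submonoid (of persistent elements); $\mathfrak g$-prime if it is an $\ell$-congruence such that $ab\equiv(ab)^\nu$ implies $a\equiv a^\nu$ or $b\equiv b^\nu$. $X=\operatorname{Spec}(A)$ is the set of all $\mathfrak g$-prime congruences ($\mathfrak P_x$ is the congruence corresponding to $x\in X$), with the Zariski topology, which has the sets $\mathcal D(f)=\{\mathfrak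 P\in X\mid f\notin\mathsf G_{\rm cls}^{-1}(\mathfrak P)\}$, $f\in A$, as a base of open sets. For a multiplicative submonoid $C\subseteq\mathcal T^\circ$, $A_C=C^{-1}A$ has fractions $\frac ac$ ($a\in A,c\in C$), $\frac ac=\frac{a'}{c'}$ iff $ac'c''=a'cc''$ for some $c''\in C$, tangible set $\{\frac ac\mid a\in\mathcal T\}$, ghost ideal $\{\frac ac\mid a\in\mathcal G\}$, ghost map $\frac ac\mapsto\frac{a^\nu}c$. $A_x:=A_{\mathsf T_{\rm cls}^{-1}(\mathfrak P_x)}$. For $f\in A$: $C(f)=\{1,f,f^2,\dots\}$ if $f\in\mathcal T^\circ$ and $C(f)=\{1\}$ otherwise; $S^*(f)=\{h\in A|^*_{\rm tng}\mid\mathcal D(f)\subseteq\mathcal D(h)\}$; $S(f)$ is the multiplicative set generated by $C(f)\cup S^*(f)$ (a multiplicative submonoid of persistent elements). The focal zone of $U=\mathcal D(f)$ is $\check U=\check{\mathcal D}(f)=\{\mathfrak P\in\mathcal D(f)\mid S(f)\subseteq\mathsf T_{\rm cls}^{-1}(\mathfrak P)\}$. $f$ is strict if $\check{\mathcal D}(f)=\mathcal D(f)$. Structure $\nu$-sheaf: for $U$ a basic open set, $\mathscr O_X(U)$ is the set of families $\sigma=(\sigma_x)_{x\in\check U}$, $\sigma_x\in A_x$, such that for every $x\in\check U$ there are a basic open neighborhood $V\subseteq U$ of $x$ with $x\in\check V$, and $f,g\in A$, such that $g\in\mathsf T_{\rm cls}^{-1}(\mathfrak P_y)$ and $\sigma_y=\frac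 fg$ in $A_y$ for all $y\in\check V$. Operations are pointwise; $\sigma$ is tangible (resp. persistent, ghost) if $\sigma_x$ is so for all $x\in\check U$. Restriction maps are the evident ones. Note $X=\mathcal D(1)$. For $x\in X$ let $\mathfrak D_x=\{\mathcal D(h)\mid h\in\mathcal T^\circ,\ x\in\check{\mathcal D}(h)\}$. The $\nu$-stalk is the inductive limit $\mathscr O_{X,x}=\varinjlim_{U\in\mathfrak D_x}\mathscr O_X(U)$. Isomorphisms are isomorphisms of $\nu$-semirings.
   Formalization: (ii) assumes D(f) nonempty (otherwise O_X(D(f)) has one element but A_{S(f)} does not); the order on ghosts is translation invariant; isomorphisms match tangibles among non-ghosts only and preserve persistent elements only from A_x, A_{S(f)}, A to the sheaf side. *)

(* Defs.v *)
From HB Require Import structures.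
From mathcomp Require Import all_boot all_order all_algebra ring.
From mathcomp Require Import boolp classical_sets.

Set Implicit Arguments.
Unset Strict Implicit.
Unset Printing Implicit Defensive.

Import GRing.Theory.
Local Open Scope ring_scope.
Local Open Scope classical_set_scope.
Local Open Scope quotient_scope.

(* The signature of a nu-semiring, without axioms.  Localizations, section    *)
(* semirings and stalks are given this signature only: for example, at a      *)
(* ghost divisor the tangible fractions and the ghost fractions may overlap.  *)
HB.mixin Record hasNu (A : Type) of GRing.ComPzSemiRing A := {
  tng : {pred A};   (* tangible elements *)
  per : {pred A};   (* persistent elements *)
  gh : {pred A};    (* ghost elements *)
  nu : A -> A }.

#[short(type="nuDataType")]
HB.structure Definition NuData := {A of hasNu A & GRing.ComPzSemiRing A}.

Definition invertible (A : nuDataType) (a : A) : Prop := exists b, a * b = 1.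

(* gle is only meaningful on ghosts, where it is the order of a partially     *)
(* ordered monoid, hence translation invariant (gle_add).  Without gle_add    *)
(* Spec may be empty: take the square of the semiring {0, 1, e}, 1 + 1 = e,   *)
(* with 0 < a as only strict relations, T = {(1,1), (1,0), (0,1)} and         *)
(* persistent set {(1,1)}.                                                    *)
HB.mixin Record NuData_isNuSemiRing (A : Type) of NuData A := {
  gle : rel A;
  gh_closed : GRing.nmod_closed (gh : {pred A});
  gle_refl : {in (gh : {pred A}), reflexive gle};
  gle_anti : {in (gh : {pred A}) &, antisymmetric gle};
  gle_trans : {in (gh : {pred A}) & &, transitive gle};
  gle_add : {in (gh : {pred A}) & &,
    forall a b c : A, gle a b -> gle (a + c) (b + c)};
  gle0 : {in (gh : {pred A}), forall a : A, a != 0 -> gle 0 a};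
  nu_gh : forall a : A, nu a \in (gh : {pred A});
  nu_id : {in (gh : {pred A}), forall a : A, nu a = a};
  nu0 : nu (0 : A) = 0;
  nuD : {morph (nu : A -> A) : a b / a + b};
  NM1 : forall a b : A, gle (nu b) (nu a) -> nu b != nu a -> a + b = a;
  NM2 : forall a b : A, nu a = nu b -> a + b = nu a;
  NM3 : forall a b : A, a + b \notin (gh : {pred A}) ->
    a + nu b \in (gh : {pred A}) -> a + b = nu a + b;
  tng_gh : forall a : A, a \in (tng : {pred A}) -> a \notin (gh : {pred A});
  per_tng : {subset (per : {pred A}) <= (tng : {pred A})};
  inv_per : forall a : A, invertible a -> a \in (per : {pred A});
  NS1 : forall (a : A) (n : nat),
    a \in (per : {pred A}) -> a ^+ n \in (per : {pred A});
  NS2 : forall a b : A, a + b \in (tng : {pred A}) ->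
    ~ (a + b = a \/ a + b = b) -> a + nu b \notin (gh : {pred A}) }.

#[short(type="nuSemiRingType")]
HB.structure Definition NuSemiRing := {A of NuData_isNuSemiRing A & NuData A}.

HB.mixin Record NuSemiRing_isTame (A : Type) of NuSemiRing A := {
  tameP : forall a : A, a \notin (tng : {pred A}) -> a \notin (gh : {pred A}) ->
    exists c d : A, [/\ c \in (tng : {pred A}), d \in (tng : {pred A}) &
                        a = c + nu d] }.

#[short(type="tameNuSemiRingType")]
HB.structure Definition TameNuSemiRing := {A of NuSemiRing_isTame A & NuSemiRing A}.

(* Isomorphism of (A, T, G, nu).  In a nu-semiring T and G are disjoint, so   *)
(* that the fourth clause says that tangible elements correspond; restricting *)
(* it to non-ghosts matters only for localizations at ghost divisors, where   *)
(* a/c = b/d may hold with a tangible and b ghost.  The persistent set is not *)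
(* a component of (A, T, G, nu); it is preserved from A to B.                 *)
Definition nu_isomorphic (A B : nuDataType) : Prop :=
  exists phi : {rmorphism A -> B},
    [/\ bijective phi,
        forall a, phi (nu a) = nu (phi a),
        forall a, (phi a \in (gh : {pred B})) = (a \in (gh : {pred A})),
        forall a, a \notin (gh : {pred A}) ->
          (phi a \in (tng : {pred B})) = (a \in (tng : {pred A}))
      & forall a, a \in (per : {pred A}) -> phi a \in (per : {pred B})].

Section Localization.
Variables (A : comPzSemiRingType) (C : mulrClosed A).

Definition fracpair := (A * {c : A | c \in C})%type.

Definition loc_eq : rel fracpair := fun x y =>
  `[< exists2 s, s \in C & x.1 * val y.2 * s = y.1 * val x.2 * s >].

Fact loc_eq_refl : reflexive loc_eq.
Proof. by move=> x; apply/asboolP; exists 1 => //; exact: rpred1. Qed.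

Fact loc_eq_sym : symmetric loc_eq.
Proof. by move=> x y; apply/asboolP/asboolP => -[s sC e]; exists s. Qed.

Fact loc_eq_trans : transitive loc_eq.
Proof.
move=> y x z /asboolP[s sC e] /asboolP[t tC e']; apply/asboolP.
exists (val y.2 * s * t); first by rewrite !rpredM // (valP y.2).
have -> : x.1 * val z.2 * (val y.2 * s * t) = x.1 * val y.2 * s * (val z.2 * t).
  by ring.
rewrite e.
have -> : y.1 * val x.2 * s * (val z.2 * t) = y.1 * val z.2 * t * (val x.2 * s).
  by ring.
by rewrite e'; ring.
Qed.

Canonical loc_equiv := EquivRel loc_eq loc_eq_refl loc_eq_sym loc_eq_trans.

Definition loc := {eq_quot loc_eq}.
HB.instance Definition _ := Choice.on loc.
HB.instance Definition _ := EqQuotient.on loc.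

Definition frac (a c : A) (cC : c \in C) : loc :=
  \pi_loc (a, exist (fun c => c \in C) c cC).

Lemma frac_eqP (a c b d : A) (cC : c \in C) (dC : d \in C) :
  frac a cC = frac b dC <-> exists2 s, s \in C & a * d * s = b * c * s.
Proof.
split=> [/eqmodP/asboolP // | h].
by apply/eqmodP/asboolP.
Qed.

Lemma frac_ind (K : loc -> Prop) :
  (forall a c (cC : c \in C), K (frac a cC)) -> forall x, K x.
Proof.
move=> h x; rewrite -[x]reprK; case: (repr x) => a [c cC]; exact: h.
Qed.

Definition loc_num (x : loc) : A := (repr x).1.
Definition loc_den (x : loc) : A := val (repr x).2.
Fact loc_den_in x : loc_den x \in C. Proof. exact: valP. Qed.

Lemma fracK x : frac (loc_num x) (loc_den_in x) = x.
Proof.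
rewrite -[RHS]reprK; apply/eqmodP/asboolP; exists 1; first exact: rpred1.
by [].
Qed.

Definition loc_zero : loc := frac 0 (rpred1 C).
Definition loc_one : loc := frac 1 (rpred1 C).
Definition loc_add (x y : loc) : loc :=
  frac (loc_num x * loc_den y + loc_num y * loc_den x)
       (rpredM (loc_den_in x) (loc_den_in y)).
Definition loc_mul (x y : loc) : loc :=
  frac (loc_num x * loc_num y) (rpredM (loc_den_in x) (loc_den_in y)).

Lemma loc_addE (a c b d : A) (cC : c \in C) (dC : d \in C) :
  loc_add (frac a cC) (frac b dC) = frac (a * d + b * c) (rpredM cC dC).
Proof.
set x := frac a cC; set y := frac b dC.
have /frac_eqP[s sC e] : frac (loc_num x) (loc_den_in x) = frac a cC.
  exact: fracK.
have /frac_eqP[t tC e'] : frac (loc_num y) (loc_den_in y) = frac b dC.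
  exact: fracK.
apply/frac_eqP; exists (s * t); first exact: rpredM.
transitivity (loc_num x * c * s * (loc_den y * d * t) +
              loc_num y * d * t * (loc_den x * c * s)); first by ring.
by rewrite e e'; ring.
Qed.

Lemma loc_mulE (a c b d : A) (cC : c \in C) (dC : d \in C) :
  loc_mul (frac a cC) (frac b dC) = frac (a * b) (rpredM cC dC).
Proof.
set x := frac a cC; set y := frac b dC.
have /frac_eqP[s sC e] : frac (loc_num x) (loc_den_in x) = frac a cC.
  exact: fracK.
have /frac_eqP[t tC e'] : frac (loc_num y) (loc_den_in y) = frac b dC.
  exact: fracK.
apply/frac_eqP; exists (s * t); first exact: rpredM.
transitivity (loc_num x * c * s * (loc_num y * d * t)); first by ring.
by rewrite e e'; ring.
Qed.

Lemma frac_eq (a c b d : A) (cC : c \in C) (dC : d \in C) :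
  a * d = b * c -> frac a cC = frac b dC.
Proof. by move=> e; apply/frac_eqP; exists 1; rewrite ?rpred1 ?e. Qed.

Fact loc_addA : associative loc_add.
Proof.
elim/frac_ind=> a c cC; elim/frac_ind=> b d dC; elim/frac_ind=> e f fC.
by rewrite !loc_addE; apply: frac_eq; ring.
Qed.

Fact loc_addC : commutative loc_add.
Proof.
elim/frac_ind=> a c cC; elim/frac_ind=> b d dC.
by rewrite !loc_addE; apply: frac_eq; ring.
Qed.

Fact loc_add0 : left_id loc_zero loc_add.
Proof.
by elim/frac_ind=> a c cC; rewrite loc_addE; apply: frac_eq; ring.
Qed.

HB.instance Definition _ := GRing.isNmodule.Build loc loc_addA loc_addC loc_add0.

Fact loc_mulA : associative loc_mul.
Proof.
elim/frac_ind=> a c cC; elim/frac_ind=> b d dC; elim/frac_ind=> e f fC.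
by rewrite !loc_mulE; apply: frac_eq; ring.
Qed.

Fact loc_mulC : commutative loc_mul.
Proof.
elim/frac_ind=> a c cC; elim/frac_ind=> b d dC.
by rewrite !loc_mulE; apply: frac_eq; ring.
Qed.

Fact loc_mul1 : left_id loc_one loc_mul.
Proof.
by elim/frac_ind=> a c cC; rewrite loc_mulE; apply: frac_eq; ring.
Qed.

Fact loc_mulDl : left_distributive loc_mul loc_add.
Proof.
elim/frac_ind=> a c cC; elim/frac_ind=> b d dC; elim/frac_ind=> e f fC.
by rewrite !(loc_mulE, loc_addE); apply: frac_eq; ring.
Qed.

Fact loc_mul0 : left_zero loc_zero loc_mul.
Proof.
by elim/frac_ind=> a c cC; rewrite loc_mulE; apply: frac_eq; ring.
Qed.

HB.instance Definition _ := GRing.Nmodule_isComPzSemiRing.Build loc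
  loc_mulA loc_mulC loc_mul1 loc_mulDl loc_mul0.

Lemma fracD (a c b d : A) (cC : c \in C) (dC : d \in C) :
  frac a cC + frac b dC = frac (a * d + b * c) (rpredM cC dC).
Proof. exact: loc_addE. Qed.

Lemma fracM (a c b d : A) (cC : c \in C) (dC : d \in C) :
  frac a cC * frac b dC = frac (a * b) (rpredM cC dC).
Proof. exact: loc_mulE. Qed.

End Localization.

Section LocalizationNu.
Variables (A : nuDataType) (C : mulrClosed A).

Definition fracs_of (S : {pred A}) : {pred loc C} := fun x =>
  `[< exists a c (cC : c \in C), a \in S /\ x = frac a cC >].

(* nu (a/c) = nu a / c when A is a nu-semiring, see nu_frac. *)
Definition loc_nu (x : loc C) : loc C := frac (nu (loc_num x)) (loc_den_in x).

HB.instance Definition _ := hasNu.Build (loc C)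
  (fracs_of tng) (fracs_of per) (fracs_of gh) loc_nu.

End LocalizationNu.

Section NuTheory.
Variable A : nuSemiRingType.
Implicit Types a b : A.

Lemma nuE a : nu a = a + a.
Proof. by rewrite NM2. Qed.

Lemma nuM a b : nu (a * b) = a * nu b.
Proof. by rewrite !nuE mulrDr. Qed.

Lemma gh_nuP a : reflect (nu a = a) (a \in (gh : {pred A})).
Proof. by apply: (iffP idP) => [/nu_id // | <-]; exact: nu_gh. Qed.

Lemma gh_mul a b : b \in (gh : {pred A}) -> a * b \in (gh : {pred A}).
Proof. by move/gh_nuP => e; apply/gh_nuP; rewrite nuM e. Qed.

Lemma nu_frac (C : mulrClosed A) a c (cC : c \in C) :
  nu (frac a cC) = frac (nu a) cC.
Proof.
change (loc_nu (frac a cC) = frac (nu a) cC).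
rewrite /loc_nu; set x := frac a cC.
have /frac_eqP[s sC e] : frac (loc_num x) (loc_den_in x) = frac a cC.
  exact: fracK.
apply/frac_eqP; exists s => //.
transitivity (nu (loc_num x * c * s)); first by rewrite !nuE !mulrDl.
by rewrite e !nuE !mulrDl.
Qed.

End NuTheory.

Section Congruences.
Variable A : nuSemiRingType.
Implicit Types (R : rel A) (a b : A).

Definition congruence R : Prop :=
  [/\ reflexive R, symmetric R, transitive R,
      forall a b c d, R a b -> R c d -> R (a + c) (b + d)
    & forall a b c d, R a b -> R c d -> R (a * c) (b * d)].

Definition ghost_proj R : {pred A} := fun a => R a (nu a).

Definition tng_proj R : {pred A} := fun a =>
  (a \in (tng : {pred A})) &&
  `[< forall t, R a t -> t \in (tng : {pred A}) >].

Definition q_congruence R : Prop :=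
  congruence R /\ forall a, invertible a -> a \in tng_proj R.

Definition l_congruence R : Prop :=
  [/\ q_congruence R, GRing.mulr_closed (tng_proj R)
    & {subset tng_proj R <= (per : {pred A})}].

Definition g_prime R : Prop :=
  l_congruence R /\
  forall a b, R (a * b) (nu (a * b)) -> R a (nu a) \/ R b (nu b).

(* A -> A -> bool instead of rel A keeps Spec in the universe of A. *)
Record Spec := MkSpec { spec_rel :> A -> A -> bool; spec_prime : g_prime spec_rel }.

Definition T_at (P : Spec) : {pred A} := tng_proj P.

Fact T_at_mulr_closed P : GRing.mulr_closed (T_at P).
Proof. by case: (spec_prime P) => -[]. Qed.

HB.instance Definition _ P :=
  GRing.isMulClosed.Build A (T_at P) (T_at_mulr_closed P).

Definition A_at (P : Spec) : nuDataType := loc (T_at P).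

Definition D (f : A) : set Spec := [set P : Spec | f \notin ghost_proj P].

Definition ghost_divisor a : Prop :=
  a \notin (gh : {pred A}) /\
  exists2 b, b \notin (gh : {pred A}) & a * b \in (gh : {pred A}).

Definition powers_of (f : A) : set A :=
  [set a | a = 1 \/ f \in (per : {pred A}) /\ exists n : nat, a = f ^+ n].

Definition S_star (f : A) : set A :=
  [set h | [/\ h \in (per : {pred A}), ~ ghost_divisor h & D f `<=` D h]].

Definition S_of (f : A) : {pred A} := fun a =>
  `[< forall M : {pred A}, GRing.mulr_closed M ->
      (forall b, powers_of f b \/ S_star f b -> b \in M) -> a \in M >].

Fact S_of_mulr_closed f : GRing.mulr_closed (S_of f).
Proof.
split=> [|a b /asboolP ha /asboolP hb]; apply/asboolP => M mM sM.
  by case: mM.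
by case: (mM) => _; apply; [exact: ha | exact: hb].
Qed.

HB.instance Definition _ f :=
  GRing.isMulClosed.Build A (S_of f) (S_of_mulr_closed f).

Definition focal (f : A) : set Spec :=
  [set P : Spec | D f P /\ {subset S_of f <= T_at P}].

Definition strict (f : A) : Prop := focal f = D f.

Definition family (f : A) := forall y : Spec, focal f y -> A_at y.

(* V = D v is the neighborhood on whose focal zone s is the fraction a/b. *)
Definition is_section (f : A) (s : family f) : Prop :=
  forall x, focal f x -> exists v a b : A,
    [/\ D v `<=` D f, focal v x
      & forall y, focal v y ->
          exists bT : b \in T_at y, forall fy : focal f y, s y fy = frac a bT].

(* Sections over D f.  The basic open set is presented by f; by focalP below  *)
(* the focal zone, hence O_X f, depends only on D f when A is tame.           *)
Record O_X (f : A) := MkSection {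
  sec_val :> forall y : Spec, focal f y -> A_at y;
  sec_prop : is_section sec_val }.

HB.instance Definition _ f := gen_eqMixin (O_X f).
HB.instance Definition _ f := gen_choiceMixin (O_X f).

Lemma sectionP f (s t : O_X f) : (forall y fy, s y fy = t y fy) -> s = t.
Proof.
case: s t => s sp [t tp] /= e; have ? : s = t.
  by do 2 apply: functional_extensionality_dep => ?; exact: e.
by subst t; congr MkSection; exact: Prop_irrelevance.
Qed.

End Congruences.

Section TameTheory.
Variable A : tameNuSemiRingType.
Implicit Types (a b f g h : A) (P x y : Spec A).

(* A consequence of the translation invariance of the order. *)
Lemma add_or_gh a b :
  [\/ a + b = a, a + b = b | a + b \in (gh : {pred A})].
Proof.
have G0 : 0 \in (gh : {pred A}) by case: (@gh_closed A).
have le0 c : c \in (gh : {pred A}) -> gle 0 c.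
  by move=> cG; have [->|c0] := eqVneq c 0; [exact: gle_refl | exact: gle0].
have leD (c d : A) : gle (nu c) (nu (c + d)).
  have := @gle_add A 0 (nu d) (nu c) G0 (nu_gh d) (nu_gh c) (le0 _ (nu_gh d)).
  by rewrite add0r nuD [nu c + _]addrC.
have [e|nab] := eqVneq (nu a) (nu b).
  by rewrite NM2 //; constructor 3; exact: nu_gh.
have [ea|na] := eqVneq (nu (a + b)) (nu a).
  constructor 1; apply: NM1; last by rewrite eq_sym.
  by rewrite -ea addrC; exact: leD.
have [eb|nb] := eqVneq (nu (a + b)) (nu b).
  constructor 2; rewrite addrC; apply: NM1 => //.
  by rewrite -eb; exact: leD.
have H (c d : A) : nu (c + d) != nu d -> c + d = c + nu d.
  move=> n; rewrite [nu d]nuE addrA; apply/esym/NM1; last by rewrite eq_sym.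
  by rewrite addrC; exact: leD.
constructor 3; rewrite H // addrC H; first by rewrite -nuD nu_gh.
by rewrite nuD [nu (nu b)]nu_id ?nu_gh // -nuD addrC.
Qed.

Lemma tng_or_gh a : a \notin (gh : {pred A}) -> a \in (tng : {pred A}).
Proof.
move=> aG; apply/negPn/negP => aT.
have [c [d [cT dT e]]] := @tameP A a aT aG.
have := add_or_gh c (nu d); rewrite -e => -[e'|e'|].
- by move: aT; rewrite e' cT.
- by move: aG; rewrite e' nu_gh.
- by rewrite (negPf aG).
Qed.

Lemma T_atE P a : (a \in T_at P) = (a \notin ghost_proj P).
Proof.
case: (spec_prime P) => -[[[Rr Rs Rt RD RM] _] _ _] _.
apply/idP/idP => [/andP[aT /asboolP h]|aN].
  by apply/negP => /h /tng_gh; rewrite nu_gh.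
apply/andP; split.
  apply: tng_or_gh; apply: contra aN => /gh_nuP e.
  by rewrite /ghost_proj unfold_in /= e Rr.
apply/asboolP => t at_; apply: tng_or_gh; apply: contra aN => /gh_nuP e.
rewrite unfold_in nuE; apply: (Rt t) => //.
by rewrite -e nuE Rs; exact: RD.
Qed.

(* All elements are strict when A is tame. *)
Lemma focalP f x : focal f x <-> D f x.
Proof.
split=> [[]//|fx]; split=> // a /asboolP; apply.
  exact: T_at_mulr_closed.
case: (T_at_mulr_closed x) => T1 TM b [[->|[_ [n ->]]]|[_ _ fb]] //.
  elim: n => [|n IH]; rewrite ?expr0 // exprS TM //.
  by rewrite T_atE; exact: fx.
by rewrite T_atE; exact: fb.
Qed.

Lemma D1 x : D 1 x.
Proof. by rewrite /D /= -T_atE; case: (T_at_mulr_closed x). Qed.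

Lemma DM a b x : D (a * b) x <-> D a x /\ D b x.
Proof.
rewrite /D /=.
case: (spec_prime x) => -[[[Rr Rs Rt RD RM] _] _ _] pr.
split=> [h|[aN bN]]; last first.
  by apply/negP => h; case: (pr a b h); apply/negP.
split; apply: contra h => h; rewrite unfold_in.
  have -> : nu (a * b) = nu a * b by rewrite mulrC nuM mulrC.
  exact: RM.
by rewrite nuM; exact: RM.
Qed.

Lemma focal_sub f g x : D g `<=` D f -> focal g x -> focal f x.
Proof. by move=> gf /focalP gx; apply/focalP/gf. Qed.

Definition res f g (gf : D g `<=` D f) (s : family f) : family g :=
  fun y gy => s y (focal_sub gf gy).

Fact res_section f g (gf : D g `<=` D f) (s : O_X f) : is_section (res gf s).
Proof.
move=> x gx; have [v [a [b [vf vx h]]]] := sec_prop s (focal_sub gf gx).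
exists (g * v), a, b; split.
- by move=> y /DM[].
- by apply/focalP/DM; split; apply/focalP.
- move=> y /focalP/DM[_ /focalP vy]; have [bT e] := h y vy.
  by exists bT => gy; exact: e.
Qed.

Definition restr f g (gf : D g `<=` D f) (s : O_X f) : O_X g :=
  MkSection (res_section gf s).

Section SectionSemiring.
Variable f : A.
Implicit Types s t : O_X f.

Fact const_section (c : A) :
  is_section (f := f) (fun y _ => frac c (rpred1 (T_at y))).
Proof.
move=> x fx; exists f, c, 1; split=> // y fy.
by exists (rpred1 (T_at y)).
Qed.

Fact add_section s t : is_section (fun y fy => s y fy + t y fy).
Proof.
move=> x fx; have [v [a [b [vf vx h]]]] := sec_prop s fx.
have [w [c [d [wf wx k]]]] := sec_prop t fx.
exists (v * w), (a * d + c * b), (b * d); split.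
- by move=> y /DM[/vf].
- by apply/focalP/DM; split; apply/focalP.
- move=> y /focalP/DM[/focalP/h[bT e] /focalP/k[dT e']].
  by exists (rpredM bT dT) => fy; rewrite e e' fracD.
Qed.

Fact mul_section s t : is_section (fun y fy => s y fy * t y fy).
Proof.
move=> x fx; have [v [a [b [vf vx h]]]] := sec_prop s fx.
have [w [c [d [wf wx k]]]] := sec_prop t fx.
exists (v * w), (a * c), (b * d); split.
- by move=> y /DM[/vf].
- by apply/focalP/DM; split; apply/focalP.
- move=> y /focalP/DM[/focalP/h[bT e] /focalP/k[dT e']].
  by exists (rpredM bT dT) => fy; rewrite e e' fracM.
Qed.

Fact nu_section s : is_section (fun y fy => nu (s y fy)).
Proof.
move=> x fx; have [v [a [b [vf vx h]]]] := sec_prop s fx.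
exists v, (nu a), b; split=> // y /h[bT e]; exists bT => fy.
by rewrite e; exact: nu_frac.
Qed.

Definition sec_zero : O_X f := MkSection (const_section 0).
Definition sec_one : O_X f := MkSection (const_section 1).
Definition sec_add s t : O_X f := MkSection (add_section s t).
Definition sec_mul s t : O_X f := MkSection (mul_section s t).
Definition sec_nu s : O_X f := MkSection (nu_section s).

Fact sec_addA : associative sec_add.
Proof. by move=> s t u; apply: sectionP => y fy /=; rewrite addrA. Qed.
Fact sec_addC : commutative sec_add.
Proof. by move=> s t; apply: sectionP => y fy /=; rewrite addrC. Qed.
Fact sec_add0 : left_id sec_zero sec_add.
Proof. by move=> s; apply: sectionP => y fy /=; rewrite add0r. Qed.

HB.instance Definition _ :=
  GRing.isNmodule.Build (O_X f) sec_addA sec_addC sec_add0.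

Fact sec_mulA : associative sec_mul.
Proof. by move=> s t u; apply: sectionP => y fy /=; rewrite mulrA. Qed.
Fact sec_mulC : commutative sec_mul.
Proof. by move=> s t; apply: sectionP => y fy /=; rewrite mulrC. Qed.
Fact sec_mul1 : left_id sec_one sec_mul.
Proof. by move=> s; apply: sectionP => y fy /=; rewrite mul1r. Qed.
Fact sec_mulDl : left_distributive sec_mul sec_add.
Proof. by move=> s t u; apply: sectionP => y fy /=; rewrite mulrDl. Qed.
Fact sec_mul0 : left_zero sec_zero sec_mul.
Proof. by move=> s; apply: sectionP => y fy /=; rewrite mul0r. Qed.

HB.instance Definition _ := GRing.Nmodule_isComPzSemiRing.Build (O_X f)
  sec_mulA sec_mulC sec_mul1 sec_mulDl sec_mul0.

Definition all_in (S : forall y : Spec A, {pred A_at y}) : {pred O_X f} :=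
  fun s => `[< forall y fy, s y fy \in S y >].

HB.instance Definition _ := hasNu.Build (O_X f)
  (all_in (fun y => tng)) (all_in (fun y => per)) (all_in (fun y => gh)) sec_nu.

End SectionSemiring.

Section Stalk.
Variable x : Spec A.

(* A section over a member D h of the system D_x. *)
Record germ := MkGerm {
  dom : A;
  dom_per : dom \in (per : {pred A});
  dom_focal : focal dom x;
  germ_sec : O_X dom }.

HB.instance Definition _ := gen_eqMixin germ.
HB.instance Definition _ := gen_choiceMixin germ.

Definition germ_eq : rel germ := fun u w =>
  `[< exists k : A, [/\ k \in (per : {pred A}), focal k x
    & exists (ku : D k `<=` D (dom u)) (kw : D k `<=` D (dom w)),
        restr ku (germ_sec u) = restr kw (germ_sec w)] >].

Lemma germ_eqP u w : reflect
  (exists k : A, [/\ k \in (per : {pred A}), D k x,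
     D k `<=` D (dom u) `&` D (dom w)
   & forall y uy wy, D k y -> germ_sec u y uy = germ_sec w y wy])
  (germ_eq u w).
Proof.
apply: (iffP (asboolP _)) => -[k [kp kx]].
  move=> [ku [kw e]]; exists k; split=> //; first exact/focalP.
    by move=> y ky; split; [exact (ku y ky) | exact (kw y ky)].
  move=> y uy wy /focalP fy.
  have := congr1 (fun s : O_X k => s y fy) e; rewrite /= /res.
  rewrite (Prop_irrelevance (focal_sub ku fy) uy).
  by rewrite (Prop_irrelevance (focal_sub kw fy) wy).
move=> kuw e; exists k; split=> //; first exact/focalP.
have ku : D k `<=` D (dom u) by move=> y /kuw[].
have kw : D k `<=` D (dom w) by move=> y /kuw[].
exists ku, kw; apply: sectionP => y ky /=.
by apply: e; apply/focalP.
Qed.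

Lemma perM h k : D h x -> D k x -> h * k \in (per : {pred A}).
Proof.
move=> hx kx; case: (spec_prime x) => -[_ [_ TM] sub] _.
by apply: sub; apply: TM; [move: hx | move: kx]; rewrite /D /= -T_atE.
Qed.

Lemma germ_eq_sub u w : D (dom u) `<=` D (dom w) ->
  (forall y uy wy, germ_sec u y uy = germ_sec w y wy) -> germ_eq u w.
Proof.
move=> uw e; apply/germ_eqP; exists (dom u); split=> //.
- exact: dom_per.
- exact/focalP/dom_focal.
- by move=> y uy; split=> //; exact: uw.
Qed.

Fact germ_eq_refl : reflexive germ_eq.
Proof.
move=> u; apply: germ_eq_sub => // y uy wy.
by rewrite (Prop_irrelevance uy wy).
Qed.

Fact germ_eq_sym : symmetric germ_eq.
Proof.
suff H u w : germ_eq u w -> germ_eq w u by move=> u w; apply/idP/idP => /H.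
move=> /germ_eqP[k [kp kx s e]]; apply/germ_eqP; exists k; split=> //.
  by move=> y /s[].
by move=> y uy wy ky; rewrite e.
Qed.

Fact germ_eq_trans : transitive germ_eq.
Proof.
move=> w u z /germ_eqP[k [kp kx s e]] /germ_eqP[l [lp lx r e']].
apply/germ_eqP; exists (k * l); split; first exact: perM.
- by apply/DM.
- by move=> y /DM[/s[uy _] /r[_ zy]].
- move=> y uy zy /DM[ky ly].
  have wy : focal (dom w) y by apply/focalP; case: (s _ ky).
  by rewrite (e y uy wy ky) e'.
Qed.

Canonical germ_equiv :=
  EquivRel germ_eq germ_eq_refl germ_eq_sym germ_eq_trans.

(* The inductive limit of the semirings O_X h along restrictions. *)
Definition stalk := {eq_quot germ_eq}.
HB.instance Definition _ := Choice.on stalk.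
HB.instance Definition _ := EqQuotient.on stalk.

Definition germ1 (s : O_X 1) : germ := MkGerm
  (@inv_per A 1 (ex_intro _ 1 (mulr1 1))) (proj2 (focalP 1 x) (D1 x)) s.

Fact domM_per u w : dom u * dom w \in (per : {pred A}).
Proof. by apply: perM; apply/focalP/dom_focal. Qed.
Fact domM_focal u w : focal (dom u * dom w) x.
Proof. by apply/focalP/DM; split; apply/focalP/dom_focal. Qed.
Fact DMl g h : D (g * h) `<=` D g. Proof. by move=> y /DM[]. Qed.
Fact DMr g h : D (g * h) `<=` D h. Proof. by move=> y /DM[]. Qed.

Definition germ_add u w : germ := MkGerm (domM_per u w) (domM_focal u w)
  (restr (@DMl _ _) (germ_sec u) + restr (@DMr _ _) (germ_sec w)).
Definition germ_mul u w : germ := MkGerm (domM_per u w) (domM_focal u w)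
  (restr (@DMl _ _) (germ_sec u) * restr (@DMr _ _) (germ_sec w)).
Definition germ_nu u : germ :=
  MkGerm (dom_per u) (dom_focal u) (nu (germ_sec u)).

Definition stalk_zero : stalk := \pi_stalk (germ1 0).
Definition stalk_one : stalk := \pi_stalk (germ1 1).
Definition stalk_add (p q : stalk) : stalk := \pi_stalk (germ_add (repr p) (repr q)).
Definition stalk_mul (p q : stalk) : stalk := \pi_stalk (germ_mul (repr p) (repr q)).
Definition stalk_nu (p : stalk) : stalk := \pi_stalk (germ_nu (repr p)).

Lemma reprE u : germ_eq (repr (\pi_stalk u)) u.
Proof. by apply/eqmodP; rewrite reprK. Qed.

Lemma germ_op_eq u u' w w' :
  germ_eq u u' -> germ_eq w w' ->
  germ_eq (germ_add u w) (germ_add u' w') /\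
  germ_eq (germ_mul u w) (germ_mul u' w').
Proof.
move=> /germ_eqP[k [kp kx s e]] /germ_eqP[l [lp lx r e']].
have sub : D (k * l) `<=` D (dom u * dom w) `&` D (dom u' * dom w').
  by move=> y /DM[/s[? ?] /r[? ?]]; split; apply/DM.
split; apply/germ_eqP; exists (k * l); split=> //; try exact: perM;
  try by apply/DM.
- move=> y uy wy /DM[ky ly]; congr (_ + _).
    exact: e.
  exact: e'.
- move=> y uy wy /DM[ky ly]; congr (_ * _).
    exact: e.
  exact: e'.
Qed.

Lemma stalk_addE u w : stalk_add (\pi_stalk u) (\pi_stalk w) = \pi_stalk (germ_add u w).
Proof. by apply/eqmodP; case: (germ_op_eq (reprE u) (reprE w)). Qed.

Lemma stalk_mulE u w : stalk_mul (\pi_stalk u) (\pi_stalk w) = \pi_stalk (germ_mul u w).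
Proof. by apply/eqmodP; case: (germ_op_eq (reprE u) (reprE w)). Qed.

Lemma stalk_nuE u : stalk_nu (\pi_stalk u) = \pi_stalk (germ_nu u).
Proof.
apply/eqmodP; have /germ_eqP[k [kp kx s e]] := reprE u.
apply/germ_eqP; exists k; split=> // y uy wy ky.
by congr nu; exact: e.
Qed.

Lemma stalk_ind (K : stalk -> Prop) : (forall u, K (\pi_stalk u)) -> forall p, K p.
Proof. by move=> h p; rewrite -[p]reprK. Qed.

Lemma stalk_eq u w : D (dom u) `<=` D (dom w) ->
  (forall y uy wy, germ_sec u y uy = germ_sec w y wy) ->
  \pi_stalk u = \pi_stalk w.
Proof. by move=> uw e; apply/eqmodP/germ_eq_sub. Qed.

Lemma sec_irr f (s : O_X f) y (p q : focal f y) : s y p = s y q.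
Proof. by rewrite (Prop_irrelevance p q). Qed.

Fact stalk_addA : associative stalk_add.
Proof.
elim/stalk_ind=> u; elim/stalk_ind=> v; elim/stalk_ind=> w.
rewrite !stalk_addE; apply: stalk_eq => [|y p q] /=; first by rewrite mulrA.
by rewrite /res /= addrA; do !congr (_ + _); exact: sec_irr.
Qed.

Fact stalk_addC : commutative stalk_add.
Proof.
elim/stalk_ind=> u; elim/stalk_ind=> v.
rewrite !stalk_addE; apply: stalk_eq => [|y p q] /=; first by rewrite mulrC.
by rewrite /res /= addrC; congr (_ + _); exact: sec_irr.
Qed.

Fact stalk_add0 : left_id stalk_zero stalk_add.
Proof.
elim/stalk_ind=> u; rewrite stalk_addE.
apply: stalk_eq => [|y p q] /=; first exact: DMr.
by rewrite /res /= add0r; exact: sec_irr.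
Qed.

HB.instance Definition _ :=
  GRing.isNmodule.Build stalk stalk_addA stalk_addC stalk_add0.

Fact stalk_mulA : associative stalk_mul.
Proof.
elim/stalk_ind=> u; elim/stalk_ind=> v; elim/stalk_ind=> w.
rewrite !stalk_mulE; apply: stalk_eq => [|y p q] /=; first by rewrite mulrA.
by rewrite /res /= mulrA; do !congr (_ * _); exact: sec_irr.
Qed.

Fact stalk_mulC : commutative stalk_mul.
Proof.
elim/stalk_ind=> u; elim/stalk_ind=> v.
rewrite !stalk_mulE; apply: stalk_eq => [|y p q] /=; first by rewrite mulrC.
by rewrite /res /= mulrC; congr (_ * _); exact: sec_irr.
Qed.

Fact stalk_mul1 : left_id stalk_one stalk_mul.
Proof.
elim/stalk_ind=> u; rewrite stalk_mulE.
apply: stalk_eq => [|y p q] /=; first exact: DMr.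
by rewrite /res /= mul1r; exact: sec_irr.
Qed.

Fact stalk_mulDl : left_distributive stalk_mul stalk_add.
Proof.
elim/stalk_ind=> u; elim/stalk_ind=> v; elim/stalk_ind=> w.
rewrite !(stalk_mulE, stalk_addE); apply: stalk_eq => [|y p q] /=.
  by move=> y /DM[/DM[? ?] ?]; apply/DM; split; apply/DM.
by rewrite /res /= mulrDl; congr (_ * _ + _ * _); exact: sec_irr.
Qed.

Fact stalk_mul0 : left_zero stalk_zero stalk_mul.
Proof.
elim/stalk_ind=> u; rewrite stalk_mulE.
apply: stalk_eq => [|y p q] /=; first exact: DMl.
by rewrite /res /= mul0r.
Qed.

HB.instance Definition _ := GRing.Nmodule_isComPzSemiRing.Build stalk
  stalk_mulA stalk_mulC stalk_mul1 stalk_mulDl stalk_mul0.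

(* A germ is tangible (persistent, ghost) when some section representing it   *)
(* is.                                                                        *)
Definition germs_of (S : forall h, {pred O_X h}) : {pred stalk} := fun p =>
  `[< exists u : germ, p = \pi_stalk u /\ germ_sec u \in S (dom u) >].

HB.instance Definition _ := hasNu.Build stalk
  (germs_of (fun h => tng)) (germs_of (fun h => per)) (germs_of (fun h => gh))
  stalk_nu.

End Stalk.

End TameTheory.

(* Main.v *)
From Pilot Require Import Defs.
From HB Require Import structures.
From mathcomp Require Import all_boot all_order all_algebra.
From mathcomp Require Import boolp classical_sets.

Import GRing.Theory.
Local Open Scope ring_scope.
Local Open Scope classical_set_scope.

Set Implicit Arguments.
Unset Strict Implicit.

(** A tame nu-semiring is the disjoint union of its tangible elements and its
ghosts, and this makes both the spectrum and the sheaf very rigid.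

The points of the spectrum are easy to produce.  The complement of the ghost
projection of a point x is T_at x, a multiplicative monoid of persistent
elements that contains the factors of its elements.  Conversely, every such
monoid T is T_at x for some x: let a and b be congruent when a = b, or when
both lie outside T and nu a = nu b.  That this respects products is clear; that
it respects sums holds because a sum in A is one of its terms or a ghost, so
that a + c can only lie in T by being equal to c, and whether c absorbs a
depends on nu a alone (glue_congruence).

Let D f be nonempty.  The divisors of the powers of f then form the smallest
such monoid containing f; they are persistent since they lie in T_at y for every
y in D f.  Let x be the point that they define.  If x lies in D v, then v
divides a power of f, so that D f is contained in D v (least_point_exists).
Hence x has no basic neighborhood inside D f other than D f: a section over D f
is one fraction on the whole of D f, and evaluation at x identifies O_X f with
A_at x (section_iso).  The denominators of A_at x are the divisors of the powers
of f.  The monoid S_of f, for f persistent, contains these powers and is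
contained in T_at x, and inverting an element inverts its divisors, so that
loc (S_of f) is A_at x (loc_widen_iso).  For f = 1 all these denominators are units, hence
O_X 1 is A itself.

The stalk at an arbitrary x is also identified with A_at x by evaluation.
A fraction a/c at x extends to D c, where c is an admissible denominator, and an
equality of two fractions at x is witnessed by an element u of T_at x, hence
holds on a neighborhood contained in D u (sections_agree_near). *)

(* Fractions in loc C, as opposed to fractions over an integral domain. *)
Local Notation frac := Pilot.Defs.frac.

(** * Isomorphisms and localizations *)

(** When non-ghosts are tangible in A, an element to which the clause on tangible
elements applies is itself tangible, so that only preservation is at stake. *)
Lemma nu_isomorphicI (A B : nuDataType) (phi : A -> B) :
  nmod_morphism phi -> monoid_morphism phi ->
  injective phi -> (forall b, exists a, phi a = b) ->
  {morph phi : a / nu a} ->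
  (forall a : A, a \notin (gh : {pred A}) -> a \in (tng : {pred A})) ->
  (forall a : A, phi a \in (gh : {pred B}) <-> a \in (gh : {pred A})) ->
  (forall a : A, a \in (tng : {pred A}) -> phi a \in (tng : {pred B})) ->
  (forall a : A, a \in (per : {pred A}) -> phi a \in (per : {pred B})) ->
  nu_isomorphic A B.
Proof.
move=> phiD phiM inj surj phiN tame phiG phiT phiP.
pose mD := GRing.isNmodMorphism.Build _ _ phi phiD.
pose mM := GRing.isMonoidMorphism.Build _ _ phi phiM.
pose F : {rmorphism A -> B} := HB.pack phi mD mM.
exists F; split=> //.
- have [g gK] := choice surj; exists g => // a; exact/inj/gK.
- by move=> a; apply/idP/idP => /phiG.
- by move=> a /tame aT; rewrite aT; exact: phiT.
Qed.

Lemma nu_isomorphic_trans (A B E : nuDataType) :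
  nu_isomorphic A B -> nu_isomorphic B E -> nu_isomorphic A E.
Proof.
move=> [phi [phib phiN phiG phiT phiP]] [psi [psib psiN psiG psiT psiP]].
exists (psi \o phi : {rmorphism A -> E}); split=> [|a|a|a aG|a aP] /=.
- exact: bij_comp.
- by rewrite phiN psiN.
- by rewrite psiG phiG.
- by rewrite psiT ?phiT ?phiG.
- exact/psiP/phiP.
Qed.

Lemma frac_in (A : nuDataType) (C : mulrClosed A) (S : {pred A}) a c
    (cC : c \in C) : a \in S -> frac a cC \in @fracs_of A C S.
Proof. by move=> aS; apply/asboolP; exists a, c, cC. Qed.

Lemma loc_tng_or_gh (A : tameNuSemiRingType) (C : mulrClosed A) (x : loc C) :
  x \notin (gh : {pred loc C}) -> x \in (tng : {pred loc C}).
Proof.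
elim/frac_ind: x => a c cC xG; apply/frac_in/tng_or_gh.
by apply: contra xG; exact: frac_in.
Qed.

(** Evaluation at a point goes from sections or germs to fractions, whereas
persistent elements are to be transported from fractions to sections.  So the
isomorphism is the inverse of ev, and each fraction needs one preimage of the
same kind as its numerator; it is the only preimage since ev is injective. *)
Lemma nu_isomorphic_of_evaluation (A : tameNuSemiRingType) (C : mulrClosed A)
    (B : nuDataType) (ev : B -> loc C) :
  nmod_morphism ev -> monoid_morphism ev -> injective ev ->
  {morph ev : b / nu b} ->
  (forall b : B, b \in (gh : {pred B}) -> ev b \in (gh : {pred loc C})) ->
  (forall a c (cC : c \in C), exists b : B,
    [/\ ev b = frac a cC,
        a \in (gh : {pred A}) -> b \in (gh : {pred B}),
        a \in (tng : {pred A}) -> b \in (tng : {pred B})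
      & a \in (per : {pred A}) -> b \in (per : {pred B})]) ->
  nu_isomorphic (loc C) B.
Proof.
move=> [ev0 evD] [ev1 evM] inj evN evG lift.
have surj x : exists b, ev b = x.
  by elim/frac_ind: x => a c cC; have [b [e _ _ _]] := lift a c cC; exists b.
have [g gK] := choice surj.
have lift_in (S : {pred A}) (SB : {pred B}) :
    (forall a c (cC : c \in C), a \in S ->
       exists2 b, ev b = frac a cC & b \in SB) ->
    forall x, x \in @fracs_of A C S -> g x \in SB.
  move=> h x /asboolP[a [c [cC [aS ->]]]]; have [b e bS] := h a c cC aS.
  by rewrite (_ : g _ = b) //; apply: inj; rewrite gK.
apply: (@nu_isomorphicI _ _ g).
- by split=> [|x y]; apply: inj; rewrite gK ?ev0 // evD !gK.
- by split=> [|x y]; apply: inj; rewrite gK ?ev1 // evM !gK.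
- exact: (can_inj gK).
- by move=> b; exists (ev b); apply: inj; rewrite gK.
- by move=> x; apply: inj; rewrite evN !gK.
- exact: loc_tng_or_gh.
- move=> x; split=> [/evG|]; first by rewrite gK.
  apply: lift_in => a c cC aG.
  by have [b [e bG _ _]] := lift a c cC; exists b; last exact: bG.
- apply: lift_in => a c cC aT.
  by have [b [e _ bT _]] := lift a c cC; exists b; last exact: bT.
- apply: lift_in => a c cC aP.
  by have [b [e _ _ bP]] := lift a c cC; exists b; last exact: bP.
Qed.

Lemma loc_units_iso (A : tameNuSemiRingType) (C : mulrClosed A) :
  (forall c, c \in C -> invertible c) -> nu_isomorphic A (loc C).
Proof.
move=> Cunit; pose phi (a : A) : loc C := frac a (rpred1 C).
have cancel_unit (a b s : A) : s \in C -> a * s = b * s -> a = b.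
  by move=> /Cunit[t st] e; rewrite -[a]mulr1 -[b]mulr1 -st !mulrA e.
have inj : injective phi.
  by move=> a b /frac_eqP[s sC]; rewrite !mulr1; exact: cancel_unit.
have phiE a c (cC : c \in C) t : c * t = 1 -> frac a cC = phi (a * t).
  by move=> ct; apply: frac_eq; rewrite mulr1 -mulrA [t * c]mulrC ct mulr1.
apply: (@nu_isomorphicI _ _ phi) => //.
- by split=> // a b; rewrite /phi fracD; apply: frac_eq; rewrite !mulr1.
- by split=> // a b; rewrite /phi fracM; apply: frac_eq; rewrite !mulr1.
- elim/frac_ind=> a c cC; have [t ct] := Cunit c cC.
  by exists (a * t); rewrite -(phiE _ _ cC).
- by move=> a; rewrite /phi nu_frac.
- exact: tng_or_gh.
- move=> a; split=> [/asboolP[g [c [cC [gG]]]]|]; last exact: frac_in.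
  have [t ct] := Cunit c cC; rewrite (phiE _ _ cC _ ct) => /inj ->.
  by rewrite mulrC; exact: gh_mul.
- by move=> a; exact: frac_in.
- by move=> a; exact: frac_in.
Qed.

(** If e divides an element of C, then e is already invertible in loc C:
a / e = (a t) / (e t) with e t in C.  The same t turns a witness of equality of
fractions that lies in E into one that lies in C. *)
Lemma loc_widen_iso (A : tameNuSemiRingType) (C E : mulrClosed A) :
  {subset C <= E} -> (forall e, e \in E -> exists t, e * t \in C) ->
  nu_isomorphic (loc C) (loc E).
Proof.
move=> CE div.
pose phi (x : loc C) : loc E := frac (loc_num x) (CE _ (loc_den_in x)).
have phi_frac a c (cC : c \in C) : phi (frac a cC) = frac a (CE _ cC).
  set x := frac a cC; have /frac_eqP[s sC e] := fracK x.
  by apply/frac_eqP; exists s; [exact (CE s sC) | exact: e].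
have inj : injective phi.
  elim/frac_ind=> a c cC; elim/frac_ind=> b d dC.
  rewrite !phi_frac => /frac_eqP[s sE e]; have [t stC] := div s sE.
  by apply/frac_eqP; exists (s * t) => //; rewrite !mulrA e.
have phiE a e (eE : e \in E) t (etC : e * t \in C) :
    frac a eE = phi (frac (a * t) etC).
  by rewrite phi_frac; apply: frac_eq; rewrite mulrA mulrAC.
apply: (@nu_isomorphicI _ _ phi).
- split=> [|]; first by rewrite phi_frac; apply: frac_eq.
  elim/frac_ind=> a c cC; elim/frac_ind=> b d dC.
  by rewrite !(phi_frac, fracD); apply: frac_eq.
- split=> [|]; first by rewrite phi_frac; apply: frac_eq.
  elim/frac_ind=> a c cC; elim/frac_ind=> b d dC.
  by rewrite !(phi_frac, fracM); apply: frac_eq.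
- exact: inj.
- elim/frac_ind=> a e eE; have [t etC] := div e eE.
  by exists (frac (a * t) etC); rewrite -phiE.
- by elim/frac_ind=> a c cC; rewrite !(phi_frac, nu_frac).
- exact: loc_tng_or_gh.
- move=> x; split=> [/asboolP[g [e [eE [gG]]]]|/asboolP[g [c [cC [gG ->]]]]].
    have [t etC] := div e eE; rewrite (phiE _ _ _ _ etC) => /inj ->.
    by apply: frac_in; rewrite mulrC; exact: gh_mul.
  by rewrite phi_frac; exact: frac_in.
- by move=> _ /asboolP[a [c [cC [aT ->]]]]; rewrite phi_frac; exact: frac_in.
- by move=> _ /asboolP[a [c [cC [aT ->]]]]; rewrite phi_frac; exact: frac_in.
Qed.

(** * Points of the spectrum *)

Section Points.
Variable A : tameNuSemiRingType.
Implicit Types (a b c f : A) (x y : Spec A).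

(** Whether a non-ghost c absorbs a depends on nu a only.  If c + nu a were a
ghost, then NM3 would give c = nu c + a, and adding c to both sides would give
c = nu c.  So c + nu a is not a ghost, hence is c, and nu a = nu b = b + nu b
absorbs b. *)
Lemma tng_sum_absorbs a b c :
  nu a = nu b -> c \notin (gh : {pred A}) -> a + c = c -> b + c = c.
Proof.
move=> eab cG ac.
have nucc : nu c + c = nu c by rewrite NM2 // nu_id ?nu_gh.
have caG : c + nu a \notin (gh : {pred A}).
  apply: (contra _ (cG)) => h; have := @NM3 A c a; rewrite [c + a]addrC ac => /(_ cG h) e.
  have -> : c = nu c.
    by rewrite [LHS]e -{1}nucc -addrA [c + a]addrC ac nucc.
  exact: nu_gh.
have e : c + nu b = c.
  rewrite -eab; have [//|e|h] := add_or_gh c (nu a).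
    by move: caG; rewrite e nu_gh.
  by move: caG; rewrite h.
have bb : b + nu b = nu b by rewrite NM2 // [nu (nu b)]nu_id ?nu_gh.
by rewrite -[in LHS]e addrCA bb.
Qed.

(** For T as in section Glue, this is the finest congruence whose ghost
projection contains the complement of T: it only identifies what must be
identified once a and nu a are, for all a outside T. *)
Definition glue (T : {pred A}) : A -> A -> bool :=
  fun a b => (a == b) || [&& a \notin T, b \notin T & nu a == nu b].

Section Glue.
Variable T : {pred A}.
Hypotheses (T_closed : GRing.mulr_closed T)
  (T_per : {subset T <= (per : {pred A})})
  (T_div : forall a b, a * b \in T -> a \in T).

Let gh_notin_T a : a \in (gh : {pred A}) -> a \notin T.
Proof. by move=> aG; apply/negP => /T_per/per_tng/tng_gh; rewrite aG. Qed.

Lemma glue_congruence : congruence (glue T).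
Proof.
have Rr : reflexive (glue T) by move=> a; rewrite /glue eqxx.
have Rs : symmetric (glue T).
  by move=> a b; rewrite /glue eq_sym [nu a == _]eq_sym andbCA.
have Rt : transitive (glue T).
  move=> b a c /orP[/eqP -> //|/and3P[aT bT /eqP e]].
  case/orP=> [/eqP <-|/and3P[_ cT /eqP e']]; apply/orP; right.
    by rewrite aT bT e eqxx.
  by rewrite aT cT e e' eqxx.
have RD a b c : glue T a b -> glue T (a + c) (b + c).
  case/orP=> [/eqP -> //|/and3P[aT bT /eqP e]].
  (* A sum in T is not a ghost, hence is a' or c, and a' lies outside T. *)
  have abs a' b' : a' \notin T -> nu a' = nu b' -> a' + c \in T ->
      a' + c = b' + c.
    move=> a'T e' h; have [e2|e2|/gh_notin_T] := add_or_gh a' c.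
    - by move: a'T; rewrite -e2 h.
    - rewrite e2; apply/esym/(tng_sum_absorbs e' _ e2).
      by apply/negP => /gh_notin_T; rewrite -e2 h.
    - by rewrite h.
  rewrite /glue !nuD e eqxx andbT.
  have [/(abs a b aT e) ->|_] := boolP (a + c \in T); first by rewrite eqxx.
  have [/(abs b a bT (esym e)) ->|_] := boolP (b + c \in T); first by rewrite eqxx.
  by rewrite orbT.
have RM a b c : glue T a b -> glue T (a * c) (b * c).
  case/orP=> [/eqP -> //|/and3P[aT bT /eqP e]]; apply/orP; right.
  rewrite (contra (@T_div a c)) // (contra (@T_div b c)) //=.
  by rewrite ![_ * c]mulrC !nuM e.
split=> // a b c d ab cd.
  by apply: (Rt (b + c)); [exact: RD | rewrite ![b + _]addrC; exact: RD].
by apply: (Rt (b * c)); [exact: RM | rewrite ![b * _]mulrC; exact: RM].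
Qed.

Lemma glue_ghost a : glue T a (nu a) = (a \notin T).
Proof.
rewrite /glue [nu (nu a)]nu_id ?nu_gh // eqxx andbT [nu a \notin T]gh_notin_T ?nu_gh // andbT.
have [e|//] := eqVneq a (nu a).
by rewrite gh_notin_T // e nu_gh.
Qed.

Lemma glue_tng : tng_proj (glue T) =i T.
Proof.
move=> a; apply/andP/idP => [[aT /asboolP h]|aT].
  apply/negPn/negP => aN; have /h/tng_gh : glue T a (nu a) by rewrite glue_ghost.
  by rewrite nu_gh.
split; first exact/per_tng/T_per.
apply/asboolP => t /orP[/eqP <-|/andP[]]; first exact/per_tng/T_per.
by rewrite aT.
Qed.

Lemma glue_prime : g_prime (glue T).
Proof.
have [T1 TM] := T_closed.
split; last first.
  move=> a b; rewrite !glue_ghost => h; apply/orP; rewrite -negb_and.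
  by apply: contra h => /andP[]; exact: TM.
split.
- split; first exact: glue_congruence.
  by move=> a [b ab]; rewrite glue_tng; apply: (@T_div a b); rewrite ab.
- by split=> [|a b]; rewrite !glue_tng //; exact: TM.
- by move=> a; rewrite glue_tng; exact: T_per.
Qed.

End Glue.

Lemma T_atD x a : (a \in T_at x) <-> D a x.
Proof. by rewrite T_atE. Qed.

Lemma D_per x a : D a x -> a \in (per : {pred A}).
Proof. by move=> /T_atD; case: (spec_prime x) => -[_ _ sub] _ /sub. Qed.

(** In other words, D f is the smallest basic neighborhood of x. *)
Definition least_point f x := D f x /\ forall v, D v x -> D f `<=` D v.

(** The saturation of the monoid of the powers of f. *)
Definition divides_power f a := exists b n, a * b = f ^+ n.

Lemma D_divides_power f a : divides_power f a -> D f `<=` D a.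
Proof.
move=> [b [n e]] y fy; apply: (proj1 (proj1 (DM a b y) _)).
by rewrite e; apply/T_atD/rpredX/T_atD.
Qed.

Lemma divides_power_per f a :
  D f !=set0 -> divides_power f a -> a \in (per : {pred A}).
Proof. by move=> [y fy] /D_divides_power/(_ y fy)/D_per. Qed.

(** The persistence of the divisors of the powers of f is what allows them to be
the monoid T_at x of a point; in particular D f is then nonempty. *)
Lemma least_point_exists f :
  (forall a, divides_power f a -> a \in (per : {pred A})) ->
  exists2 x, least_point f x & forall a, a \in T_at x -> divides_power f a.
Proof.
pose T : {pred A} := fun a => `[< divides_power f a >].
move=> div_per; have T_per : {subset T <= (per : {pred A})}.
  by move=> a /asboolP; exact: div_per.
have T_closed : GRing.mulr_closed T.
  split=> [|a b /asboolP[c [m e]] /asboolP[d [n e']]]; apply/asboolP.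
    by exists 1, 0%N; rewrite mulr1.
  by exists (c * d), (m + n)%N; rewrite mulrACA e e' exprD.
have T_div a b : a * b \in T -> a \in T.
  move=> /asboolP[c [n e]]; apply/asboolP.
  by exists (b * c), n; rewrite mulrA.
pose x := MkSpec (glue_prime T_closed T_per T_div).
have TE a : a \in T_at x -> divides_power f a.
  by rewrite (glue_tng T_per) => /asboolP.
exists x => //; split=> [|v /T_atD/TE]; last exact: D_divides_power.
apply/T_atD; rewrite (glue_tng T_per); apply/asboolP.
by exists 1, 1%N; rewrite mulr1 expr1.
Qed.

(** * Sections *)

Section FracSection.
Variables (f a c : A).
Hypothesis cT : forall y, focal f y -> c \in T_at y.

Lemma frac_is_section : is_section (fun y (fy : focal f y) => frac a (cT fy)).
Proof.
move=> x fx; exists f, a, c; split=> // y fy; exists (cT fy) => fy'.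
by rewrite (Prop_irrelevance fy fy').
Qed.

Definition frac_section : O_X f := MkSection frac_is_section.

(** S stands for gh, tng or per.  On A_at y each of them is by definition the set
of the fractions with a numerator in S A. *)
Lemma frac_section_in (S : forall B : nuDataType, {pred B}) :
  (forall y (z : A_at y), z \in @fracs_of A (T_at y) (S A) -> z \in S (A_at y)) ->
  a \in S A -> frac_section \in all_in (fun y => S (A_at y)).
Proof. by move=> SE aS; apply/asboolP => y fy; apply/SE/frac_in. Qed.

End FracSection.

(** Near x both sections are single fractions a/b and c/d; a witness u of
a/b = c/d at x remains an admissible witness on D u. *)
Lemma sections_agree_near f g (s : O_X f) (t : O_X g) x
    (fx : focal f x) (gx : focal g x) :
  s x fx = t x gx -> exists k, [/\ D k x, D k `<=` D f `&` D g
    & forall y fy gy, D k y -> s y fy = t y gy].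
Proof.
have [v [a [b [vf vx sE]]]] := sec_prop s fx.
have [w [c [d [wg wx tE]]]] := sec_prop t gx.
have [bx se] := sE x vx; have [dx te] := tE x wx.
rewrite se te => /frac_eqP[u /T_atD ux e]; exists (v * w * u); split.
- by apply/DM; split=> //; apply/DM; split; apply/focalP.
- by move=> y /DM[/DM[/vf ? /wg ?] _].
move=> y fy gy /DM[/DM[/focalP vy /focalP wy] /T_atD uy].
have [bT ->] := sE y vy; have [dT ->] := tE y wy.
by apply/frac_eqP; exists u.
Qed.

(** Whatever happens near x happens on all of D f: two sections that agree near x
are equal, and a denominator in T_at x is admissible at every point of D f. *)
Lemma section_iso f x : least_point f x -> nu_isomorphic (A_at x) (O_X f).
Proof.
move=> [fx least]; have fx' : focal f x by apply/focalP.
apply: (@nu_isomorphic_of_evaluation _ _ _ (fun s : O_X f => s x fx')) => //.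
- move=> s t /sections_agree_near[k [kx _ st]]; apply: sectionP => y fy.
  by apply: st; apply: least kx _ _; apply/focalP.
- by move=> s /asboolP; apply.
- move=> a c cT.
  have cTy y : focal f y -> c \in T_at y.
    by move=> /focalP; move/T_atD: cT => /least h /h /T_atD.
  exists (frac_section a cTy); split=> /=.
  + exact: frac_eq.
  + exact: (@frac_section_in _ _ _ _ (fun B => @gh B)).
  + exact: (@frac_section_in _ _ _ _ (fun B => @tng B)).
  + exact: (@frac_section_in _ _ _ _ (fun B => @per B)).
Qed.

Lemma basic_open_iso f : f \in (per : {pred A}) -> D f !=set0 ->
  nu_isomorphic (loc (S_of f)) (O_X f).
Proof.
move=> fP fn.
have [x fx Tx] := least_point_exists (fun a => divides_power_per fn).
apply: (nu_isomorphic_trans _ (section_iso fx)).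
apply: loc_widen_iso => [|a /Tx[b [n e]]].
  by have [_ sub] : focal f x by apply/focalP; case: fx.
exists b; rewrite e; apply: rpredX; apply/asboolP => M _; apply.
by left; right; split=> //; exists 1%N; rewrite expr1.
Qed.

(** The divisors of the powers of 1 are the units, which are persistent.  So the
spectrum is nonempty and has a point whose denominators are the units, and the
monoid S_of 1 consists of units. *)
Lemma global_sections_iso : nu_isomorphic A (O_X (1 : A)).
Proof.
have unit1 a : divides_power 1 a -> invertible a.
  by move=> [b [n ab]]; exists b; rewrite ab expr1n.
have [x x1 Tx] := least_point_exists (fun a h => @inv_per A a (unit1 a h)).
have P1 : (1 : A) \in (per : {pred A}) by apply: inv_per; exists 1; rewrite mulr1.
have D1n : D (1 : A) !=set0 by exists x; exact: D1.
apply: (nu_isomorphic_trans _ (basic_open_iso P1 D1n)).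
apply: loc_units_iso => c cS; apply/unit1/Tx.
have [_ sub] : focal 1 x by apply/focalP; case: x1.
exact: sub.
Qed.

(** * Stalks *)

Section StalkIso.
Variable x : Spec A.

Definition stalk_eval (p : stalk x) : A_at x :=
  germ_sec (repr p) x (dom_focal (repr p)).

Lemma stalk_evalE (u : germ x) :
  stalk_eval (\pi_(stalk x)%qT u) = germ_sec u x (dom_focal u).
Proof. by have /germ_eqP[k [_ kx _]] := reprE u; apply. Qed.

Lemma stalk_iso : nu_isomorphic (A_at x) (stalk x).
Proof.
apply: (@nu_isomorphic_of_evaluation _ _ _ stalk_eval).
- split=> [|p q]; first exact: (stalk_evalE (germ1 x 0)).
  elim/stalk_ind: p => u; elim/stalk_ind: q => w.
  rewrite [X in stalk_eval X](stalk_addE u w).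
  rewrite !stalk_evalE /=.
  by rewrite /res; congr (_ + _); exact: sec_irr.
- split=> [|p q]; first exact: (stalk_evalE (germ1 x 1)).
  elim/stalk_ind: p => u; elim/stalk_ind: q => w.
  rewrite [X in stalk_eval X](stalk_mulE u w).
  rewrite !stalk_evalE /=.
  by rewrite /res; congr (_ * _); exact: sec_irr.
- elim/stalk_ind=> u; elim/stalk_ind=> w.
  rewrite !stalk_evalE.
  move=> /sections_agree_near[k [kx ksub st]]; apply/eqmodP/germ_eqP.
  by exists k; split=> //; exact: D_per kx.
- move=> p; elim/stalk_ind: p => u; rewrite [X in stalk_eval X](stalk_nuE u).
  by rewrite !stalk_evalE.
- move=> _ /asboolP[u [-> /asboolP uG]].
  by rewrite stalk_evalE; exact: uG.
- move=> a c cT.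
  have cx : D c x by apply/T_atD.
  have cTy y : focal c y -> c \in T_at y by move=> /focalP/T_atD.
  pose u := MkGerm (D_per cx) (proj2 (focalP c x) cx) (frac_section a cTy).
  exists (\pi_(stalk x)%qT u); split.
  + by rewrite stalk_evalE; exact: frac_eq.
  + move=> aS; apply/asboolP; exists u; split=> //.
    exact: (@frac_section_in _ _ _ _ (fun B => @gh B)).
  + move=> aS; apply/asboolP; exists u; split=> //.
    exact: (@frac_section_in _ _ _ _ (fun B => @tng B)).
  + move=> aS; apply/asboolP; exists u; split=> //.
    exact: (@frac_section_in _ _ _ _ (fun B => @per B)).
Qed.

End StalkIso.
End Points.

(* D f !=set0 excludes a degenerate case: over the empty open set O_X f is    *)
(* the zero semiring, while 1 != 0 in every loc (S_of f) with f persistent.   *)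
Theorem theorem7p20 (A : tameNuSemiRingType) :
  [/\ forall x : Spec A, nu_isomorphic (A_at x) (stalk x),
      forall f : A, f \in (per : {pred A}) -> strict f -> D f !=set0 ->
        nu_isomorphic (loc (S_of f)) (O_X f)
    & nu_isomorphic A (O_X (1 : A))].
Proof.
split; first exact: stalk_iso.
  by move=> f fP _; exact: basic_open_iso.
exact: global_sections_iso.
Qed.
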